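(* Let $c_1<c_2<\cdots<c_{l+1}$ be real numbers ($l\ge1$), let $I_i=[c_i,c_{i+1}]$, and let $f_i:I_i\to[c_1,c_{l+1}]$, $1\le i\le l$, be continuous and strictly monotone (the branches of a piecewise continuous, piecewise strictly monotone map of $[c_1,c_{l+1}]$). Assume that the topological entropy $\log s$ of $\mathcal{F}=\{f_1,\ldots,f_l\}$ is positive. Then there exist a continuous, surjective, non-decreasing map $\varphi:[c_1,c_{l+1}]\to[0,1]$, points $0=\widetilde c_1\le\widetilde c_2\le\cdots\le\widetilde c_{l+1}=1$ with $\varphi(I_i)=\widetilde I_i:=[\widetilde c_i,\widetilde c_{i+1}]$ for $1\le i\le l$ (the intervals $\widetilde I_i$ being possibly degenerate), and affine maps $\widetilde f_i:\widetilde I_i\to[0,1]$ of the form $$\widetilde f_i(y)=\sigma(f_i)\,s\,(y-\widetilde c_i)+\widetilde f_i(\widetilde c_i),$$ such that $\widetilde f_i\circ\varphi=\varphi\circ f_i$ on $I_i$ for every $1\le i\le l$. In particular $\mathcal{F}$ in $[c_1,c_{l+1}]$ is semiconjugate to a (possibly degenerate) system of affine maps with slopes $\pm s$ in $[0,1]$.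
   Context: $\sigma(f_i)=1$ if $f_i$ is increasing and $-1$ if $f_i$ is decreasing. For $m\ge1$, $\ell(m)$ is the number of words $(i_1,\ldots,i_m)\in\{1,\ldots,l\}^m$ such that the natural domain of $f_{i_m}\circ\cdots\circ f_{i_1}$ has nonempty interior; $s=\limsup_{m\to\infty}\ell(m)^{1/m}$ and the topological entropy of $\mathcal{F}$ is $\log s$. An interval is degenerate if it is a single point. *)

(* Defs.v *)
From mathcomp Require Import all_boot all_order all_algebra.
From mathcomp Require Import all_classical all_reals all_analysis.
Set Implicit Arguments.
Unset Strict Implicit.
Unset Printing Implicit Defensive.
Import Order.TTheory GRing.Theory Num.Theory.
Import numFieldNormedType.Exports.
Local Open Scope classical_set_scope.
Local Open Scope ring_scope.

(* Indices are shifted by one: c_1, ..., c_{l+1} is c : 'I_l.+1 -> R, and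
   f_1, ..., f_l is f : 'I_l -> R -> R.  Each f i is a total function of which
   only the restriction to the i-th interval is ever used. *)

Definition lpt (R : realType) (l : nat) (c : 'I_l.+1 -> R) (i : 'I_l) : R :=
  c (widen_ord (leqnSn l) i).

Definition rpt (R : realType) (l : nat) (c : 'I_l.+1 -> R) (i : 'I_l) : R :=
  c (lift ord0 i).

Definition piece (R : realType) (l : nat) (c : 'I_l.+1 -> R) (i : 'I_l)
  : interval R := `[lpt c i, rpt c i].

Definition whole (R : realType) (l : nat) (c : 'I_l.+1 -> R) : interval R :=
  `[c ord0, c ord_max].

Definition increasing_on (R : realType) (I : interval R) (g : R -> R) : Prop :=
  {in I &, {homo g : x y / x < y}}.

Definition decreasing_on (R : realType) (I : interval R) (g : R -> R) : Prop :=
  {in I &, {homo g : x y /~ x < y}}.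

(* The two alternatives exclude each other when I has at least two points. *)
Definition sigma (R : realType) (I : interval R) (g : R -> R) : R :=
  if `[< increasing_on I g >] then 1 else -1.

(* Natural domain of f_{i_m} o ... o f_{i_1} for w = [:: i_1; ...; i_m]: the
   head of w is applied first. *)
Fixpoint natural_domain (R : realType) (l : nat) (c : 'I_l.+1 -> R)
    (f : 'I_l -> R -> R) (w : seq 'I_l) : set R :=
  if w is i :: w' then
    [set` piece c i] `&` f i @^-1` natural_domain c f w'
  else [set` whole c].

Definition ell (R : realType) (l : nat) (c : 'I_l.+1 -> R)
    (f : 'I_l -> R -> R) (m : nat) : nat :=
  #|[pred w : m.-tuple 'I_l | `[< interior (natural_domain c f w) !=set0 >]]|.

(* The sequence is bounded (by maxn l 1), so that its real-valued limsup is
   meaningful; the term at m = 0 does not affect it. *)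
Definition growth (R : realType) (l : nat) (c : 'I_l.+1 -> R)
    (f : 'I_l -> R -> R) : R :=
  limn_sup (fun m : nat => (ell c f m)%:R `^ (m%:R)^-1).

Definition entropy (R : realType) (l : nat) (c : 'I_l.+1 -> R)
    (f : 'I_l -> R -> R) : R := ln (growth c f).

(* Main.v *)
Require Import Defs.
From mathcomp Require Import all_boot all_order all_algebra.
From mathcomp Require Import all_classical all_reals all_analysis.
From mathcomp Require Import ring lra zify.
Set Implicit Arguments.
Unset Strict Implicit.
Unset Printing Implicit Defensive.
Import Order.TTheory GRing.Theory Num.Theory.
Import numFieldNormedType.Exports.
Local Open Scope classical_set_scope.
Local Open Scope ring_scope.

(** For an interval J let L_m(J) be the number of words of length m whose natural
    domain meets J in more than one point.  Cutting J at a point changes L_m by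
    at most 1, and L_(m+1)(J) = L_m(f_i(J)) when J is contained in I_i.  Weight the
    L_m(J) by s^-m and normalise the partial sums up to N by those of the whole
    interval, T_N.  As m |-> L_m(whole) is submultiplicative, every weighted term
    is at least 1, so T_N -> oo while the cutting defects add up to at most
    s / (s - 1); and since s is the growth rate, the last weighted term is o(T_N)
    along some sequence of N, so shifting m by one multiplies the limit by s.  An
    ultrafilter limit along this sequence gives a finitely additive J |-> Lambda(J) with
    Lambda(f_i(J)) = s Lambda(J), and phi(x) = Lambda([c_1, x]).  The oscillation
    of phi on the domain of a word of length m is at most s^-m; finitely many such
    domains, all closed, cover the interval, whence phi is continuous. *)

(** * Growth rates of submultiplicative sequences *)

Section Growth.
Variable R : realType.
Implicit Types (u : nat -> R) (q s : R).

Lemma limn_sup_lt_near u q : bounded_fun u -> limn_sup u < q ->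
  \forall n \near \oo, u n < q.
Proof.
move=> bu; rewrite limn_supE // => infq.
have hi : has_inf (range (sups u)).
  by split; [exists (sups u 0%N), 0%N | exact: bounded_fun_has_lbound_sups].
move: (infq); rewrite -subr_gt0 => /inf_adherent /(_ hi) [_ [n _ <-]].
rewrite addrC subrK => snq.
exists n => // m /= nm; apply: le_lt_trans snq.
apply: ub_le_sup; last by exists m.
by apply: has_ubound_sdrop; exact: bounded_fun_has_ubound.
Qed.

Lemma limn_sup_le_near u q : bounded_fun u ->
  (\forall n \near \oo, u n <= q) -> limn_sup u <= q.
Proof.
move=> bu [n _ unq]; rewrite limn_supE //.
apply: (@le_trans _ _ (sups u n)).
  by apply: ge_inf; [exact: bounded_fun_has_lbound_sups | exists n].
apply: ge_sup; first by exists (u n), n => //=.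
by move=> _ [m /= nm <-]; exact: unq.
Qed.

Lemma root_le_exp x q m : 0 <= x -> 0 <= q -> (0 < m)%N ->
  (x `^ (m%:R^-1) <= q) = (x <= q ^+ m).
Proof.
move=> x0 q0 m0.
have m0' : (m%:R : R) != 0 by rewrite pnatr_eq0 -lt0n.
rewrite -(@ler_pXn2r _ m) ?nnegrE ?powR_ge0 //.
by rewrite -[X in X <= _]powR_mulrn ?powR_ge0 // -powRrM mulVf // powRr1.
Qed.

Variable L : nat -> R.
Hypothesis L_ge0 : forall m, 0 <= L m.
Hypothesis L0 : L 0%N = 1.
Hypothesis L_sub : forall m n, L (m + n)%N <= L m * L n.
Let s := limn_sup (fun m => L m `^ (m%:R^-1)).
Hypothesis s_gt1 : 1 < s.

Lemma submul_le_exp m : L m <= L 1%N ^+ m.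
Proof.
elim: m => [|m IH]; first by rewrite L0 expr0.
by rewrite -addn1 exprD expr1; apply: le_trans (L_sub _ _) _; rewrite ler_wpM2r.
Qed.

Lemma bounded_root : bounded_fun (fun m => L m `^ (m%:R^-1)).
Proof.
rewrite /bounded_fun /bounded_near; near=> M.
move=> m _ /=; rewrite ger0_norm ?powR_ge0 //.
(* At [m = 0] the exponent [0^-1] is 0, so the term is 1 and the bound must cover this value too. *)
have [->|m0] := posnP m; first by rewrite invr0 powRr0.
apply: (@le_trans _ _ (L 1%N)); last by [].
by rewrite root_le_exp // submul_le_exp.
Unshelve. all: by end_near.
Qed.

Lemma growth_upper q : s < q -> \forall m \near \oo, L m <= q ^+ m.
Proof.
move=> sq; have q0 : 0 <= q by rewrite ltW // (lt_trans _ sq) // (lt_trans ltr01).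
have := limn_sup_lt_near bounded_root sq.
move=> /filterI/(_ (nbhs_infty_gt 0%N)); apply: filterS => m [+ m0].
by move/ltW; rewrite root_le_exp.
Qed.

Lemma growth_le q : 0 <= q -> (\forall m \near \oo, L m <= q ^+ m) -> s <= q.
Proof.
move=> q0 h; apply: limn_sup_le_near; first exact: bounded_root.
move: h => /filterI/(_ (nbhs_infty_gt 0%N)); apply: filterS => m [+ m0].
by rewrite root_le_exp.
Qed.

Lemma exp_eventually_large (C q : R) : 1 < q -> \forall m \near \oo, C <= q ^+ m.
Proof.
move=> q1.
have [C0|C0] := leP C 0.
  by apply: nearW => m; rewrite (le_trans C0) // exprn_ge0 // (le_trans ler01) // ltW.
have q0 : 0 < q by rewrite (lt_trans ltr01).
have : C * q^-1 ^+ n @[n --> \oo] --> 0.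
  by apply: cvg_geometric; rewrite ger0_norm ?invr_ge0 1?ltW // invf_lt1.
move/cvgr_le => /(_ 1 ltr01); apply: filterS => n /=.
by rewrite exprVn ler_pdivrMr ?exprn_gt0 // mul1r.
Qed.

(** Half of Fekete's lemma. If [L n < s ^+ n], then [L n <= p ^+ n] for some [p < s]; splitting off
    blocks of length [n] gives [L m <= C * p ^+ m] for all [m], which makes the growth rate smaller
    than [s]. *)
Lemma growth_lower n : s ^+ n <= L n.
Proof.
have s0 : 0 < s by rewrite (lt_trans ltr01).
rewrite leNgt; apply/negP => Ln.
have n0 : (0 < n)%N by case: n Ln => //; rewrite L0 expr0 ltxx.
have [p [p1 ps Lnp]] : exists p, [/\ 1 <= p, p < s & L n <= p ^+ n].
  (* The maximum with 1 ensures [p ^+ m >= 1], so that [C] alone settles the lengths [m < n]. *)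
  exists (Num.max 1 (L n `^ (n%:R^-1))); split; first by rewrite le_max lexx.
    rewrite gt_max s_gt1 -(@ltr_pXn2r _ n) ?nnegrE ?powR_ge0 1?ltW //=.
    by rewrite -powR_mulrn ?powR_ge0 // -powRrM mulVf ?powRr1 // pnatr_eq0 -lt0n.
  by rewrite -root_le_exp ?le_max ?ler01 ?lexx ?orbT.
have p0 : 0 < p by rewrite (lt_le_trans ltr01).
pose C := 1 + \sum_(k < n) L k.
have C0 : 0 < C by rewrite ltr_pwDl // sumr_ge0.
have LC m : L m <= C * p ^+ m.
  elim/ltn_ind: m => m IH; have [mn|nm] := ltnP m n.
    apply: (@le_trans _ _ C); last by rewrite ler_peMr ?exprn_ege1 // ltW.
    by rewrite /C (bigD1 (Ordinal mn)) //= addrCA lerDl addr_ge0 // sumr_ge0.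
  rewrite -(subnKC nm); apply: le_trans (L_sub _ _) _.
  rewrite exprD mulrCA; apply: ler_pM => //; apply: IH; lia.
(* Any rate strictly between [p] and [s] eventually absorbs the constant [C]. *)
pose q := (p + s) / 2.
have pq : p < q by rewrite /q; lra.
have qs : q < s by rewrite /q; lra.
have q0 : 0 < q by rewrite (lt_trans p0).
suff : s <= q by rewrite leNgt qs.
apply: growth_le; first exact: ltW.
have qp1 : 1 < q / p by rewrite ltr_pdivlMr // mul1r.
have := exp_eventually_large C qp1; apply: filterS => m.
rewrite expr_div_n ler_pdivlMr ?exprn_gt0 //; exact: le_trans.
Qed.

(* Otherwise the partial sums, hence also the terms, of the series
   [L m / s ^+ m] would grow at least like [(1 + eps) ^+ m]. *)
Lemma exists_small_term eps : 0 < eps ->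
  exists N, L N / s ^+ N <= eps * \sum_(m < N) L m / s ^+ m.
Proof.
move=> e0; apply/not_existsP => H.
have s0 : 0 < s by rewrite (lt_trans ltr01).
pose T N := \sum_(m < N) L m / s ^+ m.
have {}H N : eps * T N < L N / s ^+ N by rewrite ltNge; apply/negP.
(* The sum stops before [N], so [T 0 = 0] and the induction has to start from [T 1 = L 0 = 1]. *)
have T1 N : (1 + eps) ^+ N <= T N.+1.
  elim: N => [|N IH].
    by rewrite /T big_ord_recr big_ord0 /= L0 !expr0 divr1 add0r.
  rewrite /T big_ord_recr /= -/(T N.+1) exprS.
  apply: (@le_trans _ _ ((1 + eps) * T N.+1)); first by rewrite ler_wpM2l // addr_ge0 // ltW.
  by rewrite mulrDl mul1r lerD2l ltW.
(* As [q > s], the terms are eventually at most [(1 + eps / 2) ^+ m], which is too slow for the rate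
   [1 + eps] in [T1]; [r] is the ratio of the two rates. *)
pose q := s * (1 + eps / 2).
have sq : s < q by rewrite /q ltr_pMr //; lra.
pose r := (1 + eps) / (1 + eps / 2).
have e2 : 0 < 1 + eps / 2 by lra.
have r1 : 1 < r by rewrite /r ltr_pdivlMr //; lra.
have [N0 _ upper] := growth_upper sq.
have [N1 _ large] := exp_eventually_large ((1 + eps / 2) / eps) r1.
pose n := maxn N0 N1.
have := large n (leq_maxr _ _); rewrite leNgt => /negP; apply.
rewrite ltr_pdivlMr // /r expr_div_n mulrAC.
rewrite ltr_pdivrMr ?exprn_gt0 // -exprS (@le_lt_trans _ _ (eps * T n.+1)) //.
  by rewrite mulrC ler_wpM2l // ltW.
apply: lt_le_trans (H n.+1) _; rewrite ler_pdivrMr ?exprn_gt0 // -exprMn.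
by rewrite mulrC upper //=; exact: leq_trans (leq_maxl _ _) (leqnSn _).
Qed.

End Growth.
(** * Words and natural domains *)

Section Words.
Variables (R : realType) (l : nat) (c : 'I_l.+1 -> R).
Hypothesis hc : {homo c : i j / (i < j)%N >-> i < j}.
Variable f : 'I_l -> R -> R.
Hypothesis f_cont : forall i, {within [set` piece c i], continuous (f i)}.
Hypothesis f_mono : forall i,
  increasing_on (piece c i) (f i) \/ decreasing_on (piece c i) (f i).
Hypothesis f_maps : forall i, {homo f i : x / x \in piece c i >-> x \in whole c}.

Implicit Types (A B : set R) (w : seq 'I_l) (i j : 'I_l) (x y z p q : R).

Local Notation D := (natural_domain c f).

Lemma c_le (i j : 'I_l.+1) : (i <= j)%N -> c i <= c j.
Proof. by rewrite leq_eqVlt => /orP[/eqP/val_inj->//|/hc/ltW]. Qed.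

Lemma lpt_lt_rpt i : lpt c i < rpt c i.
Proof. by apply: hc. Qed.

Lemma piece_sub_whole i x : x \in piece c i -> x \in whole c.
Proof.
rewrite !in_itv /= => /andP[h1 h2]; apply/andP; split.
  by apply: le_trans h1; exact: c_le.
by apply: le_trans h2 _; apply: c_le; rewrite -ltnS ltn_ord.
Qed.

Lemma piece_inj i j p q : p < q -> p \in piece c i -> q \in piece c i ->
  p \in piece c j -> q \in piece c j -> i = j.
Proof.
move=> pq; rewrite !in_itv /= => /andP[ip _] /andP[_ qi] /andP[jp _] /andP[_ qj].
have step i1 i2 : (i1 < i2)%N -> lpt c i2 <= p -> q <= rpt c i1 -> False.
  move=> i12 h1 h2; have : rpt c i1 <= lpt c i2 by apply: c_le.
  by move=> h3; have := lt_le_trans pq (le_trans h2 (le_trans h3 h1)); rewrite ltxx.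
by case: (ltngtP i j) => [/step|/step|/val_inj//]; move=> /(_ _ _) [].
Qed.

Lemma f_inj i x y : x \in piece c i -> y \in piece c i -> x != y -> f i x != f i y.
Proof.
move=> xi yi; rewrite !neq_lt.
have [inc|dec] := f_mono i => /orP[] xy; apply/orP.
- by left; exact: inc.
- by right; exact: inc.
- by right; exact: dec.
- by left; exact: dec.
Qed.

Lemma domain_sub_whole w x : D w x -> x \in whole c.
Proof. by case: w => [//|i w [/piece_sub_whole]]. Qed.

(** A monotone branch preserves betweenness, so the induction passes to the images, with the outer
    points exchanged when the branch is decreasing. *)
Lemma domain_convex w x y z : D w x -> D w z -> x <= y -> y <= z -> D w y.
Proof.
elim: w x y z => [|i w IH] x y z /=.
  rewrite !in_itv /= => /andP[h1 _] /andP[_ h2] h3 h4; apply/andP.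
  by split; [exact: le_trans h3 | exact: le_trans h2].
move=> [xi xw] [zi zw] xy yz.
have yi : y \in piece c i.
  move: xi zi; rewrite /= !in_itv /= => /andP[h1 _] /andP[_ h2]; apply/andP.
  by split; [exact: le_trans xy | exact: le_trans h2].
split => //=.
have [->//|nxy] := eqVneq y x; have [->//|nyz] := eqVneq y z.
have {}xy : x < y by rewrite lt_neqAle eq_sym nxy.
have {}yz : y < z by rewrite lt_neqAle nyz.
have [inc|dec] := f_mono i.
  by apply: (IH (f i x) _ (f i z)) => //; apply/ltW/inc.
by apply: (IH (f i z) _ (f i x)) => //; apply/ltW/dec.
Qed.

Lemma domain_cat_l u w x : D (u ++ w) x -> D u x.
Proof.
elim: u x => [|i u IH] x /=; first exact: domain_sub_whole.
by move=> [xi /IH].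
Qed.

(* Since natural domains are convex, two distinct points replace nonempty
   interior (interior_domainP); in this form the condition transports along
   injective maps. *)
Definition meets A w : Prop :=
  exists p q, [/\ A p, A q, D w p, D w q & p != q].

Lemma meetsP A w :
  meets A w <-> exists p q, [/\ A p, A q, D w p, D w q & p < q].
Proof.
split=> [[p [q [Ap Aq Dp Dq]]]|[p [q [Ap Aq Dp Dq pq]]]].
  by rewrite neq_lt => /orP[] pq; [exists p, q | exists q, p].
by exists p, q; split => //; rewrite lt_eqF.
Qed.

Lemma meets_sub A B w : A `<=` B -> meets A w -> meets B w.
Proof. by move=> AB [p [q [Ap Aq Dp Dq pq]]]; exists p, q; split; auto. Qed.

Lemma meets_cat_r A u w : meets A (u ++ w) -> meets [set` whole c] w.
Proof.
elim: u A => [|i u IH] A /= [p [q [Ap Aq Dp Dq pq]]].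
  by exists p, q; split => //; apply: (domain_sub_whole (w := w)).
move: Dp Dq => [pi Dp] [qi Dq].
suff /IH : meets [set` whole c] (u ++ w) by [].
by exists (f i p), (f i q); split; rewrite //= ?f_maps // f_inj.
Qed.

(** Two common points determine the first letter, and by injectivity their images are two common
    points of the remaining domains. *)
Lemma domain_overlap_inj u w p q : size u = size w -> p < q ->
  D u p -> D u q -> D w p -> D w q -> u = w.
Proof.
elim: u w p q => [|i u IH] [|j w] p q //= [suw] pq [pi up] [qi uq] [pj wp] [qj wq].
have ij : i = j by apply: (piece_inj pq).
subst j; congr (_ :: _).
have := f_inj pi qi; rewrite lt_eqF // => /(_ isT).
by rewrite neq_lt => /orP[] fpq; apply: (IH _ _ _ suw fpq).
Qed.

Lemma interior_domainP w : interior (D w) !=set0 <-> meets [set` whole c] w.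
Proof.
split.
  move=> [x]; rewrite /interior /= => -[e /= e0 De]; exists x, (x + e / 2).
  have Dx : D w x by apply: De; exact: ballxx.
  have Dy : D w (x + e / 2).
    apply: De; rewrite /ball /= opprD addNKr normrN ger0_norm ?divr_ge0 1?ltW //.
    by rewrite ltr_pdivrMr // ltr_pMr // ltr1n.
  split => //; try exact: (domain_sub_whole (w := w)).
  by rewrite -subr_eq0 opprD addNKr oppr_eq0 mulf_neq0 ?gt_eqF ?invr_gt0.
move/meetsP => [p [q [_ _ Dp Dq pq]]]; exists ((p + q) / 2).
have : open_nbhs ((p + q) / 2) `]p, q[%classic.
  by split; [exact: interval_open | rewrite /= in_itv /= midf_lt // midf_lt].
move/open_nbhs_nbhs; apply: filterS => x /=; rewrite in_itv /= => /andP[/ltW px /ltW xq].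
exact: domain_convex px xq.
Qed.

Definition cnt A m : nat := #|[pred w : m.-tuple 'I_l | `[< meets A w >]]|.

Lemma ell_cnt m : ell c f m = cnt [set` whole c] m.
Proof.
apply: eq_card => w; rewrite !finset.inE; apply/asboolP/asboolP => /interior_domainP //.
Qed.

Lemma cnt_sub A B m : A `<=` B -> (cnt A m <= cnt B m)%N.
Proof.
move=> AB; apply/subset_leq_card/fintype.subsetP => w; rewrite !finset.inE => /asboolP h.
by apply/asboolP; exact: meets_sub AB h.
Qed.

Lemma cnt_itv_xx x m : cnt [set` `[x, x]] m = 0%N.
Proof.
apply: eq_card0 => w; rewrite !finset.inE; apply/asboolP => -[p [q [+ + _ _]]].
by rewrite /= !itvxx => /eqP-> /eqP->; rewrite eqxx.
Qed.

Lemma cnt_split x y z m : x <= y -> y <= z ->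
  (cnt [set` `[x, z]] m <= cnt [set` `[x, y]] m + cnt [set` `[y, z]] m)%N.
Proof.
move=> xy yz; rewrite /cnt -cardUI; apply: leq_trans (leq_addr _ _).
apply/subset_leq_card/fintype.subsetP => w; rewrite !finset.inE => /asboolP /meetsP.
move=> [p [q [+ + Dp Dq pq]]]; rewrite /= !in_itv /= => /andP[xp pz] /andP[xq qz].
have [qy|yq] := leP q y.
  apply/orP; left; apply/asboolP/meetsP; exists p, q.
  by split; rewrite //= in_itv /= ?xp ?xq ?qy // ltW // (lt_le_trans pq).
have [yp|py] := leP y p.
  apply/orP; right; apply/asboolP/meetsP; exists p, q.
  by split; rewrite //= in_itv /= ?yp ?pz ?qz // ltW.
(* Here [p < y < q]: by convexity [y] lies in the domain and can replace [q]. *)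
apply/orP; left; apply/asboolP/meetsP; exists p, y; split => //=.
- by rewrite in_itv /= xp ltW.
- by rewrite in_itv /= xy lexx.
- by apply: domain_convex Dp Dq _ _; exact: ltW.
Qed.

(* The cut point [y] lies inside at most one domain of a word of length [m]. *)
Lemma cnt_join x y z m : x <= y -> y <= z ->
  (cnt [set` `[x, y]] m + cnt [set` `[y, z]] m <= cnt [set` `[x, z]] m + 1)%N.
Proof.
move=> xy yz; rewrite /cnt -cardUI; apply: leq_add.
  apply/subset_leq_card/fintype.subsetP => w; rewrite !finset.inE.
  move=> /orP[] /asboolP h; apply/asboolP; move: h; apply: meets_sub => t /=;
    rewrite !in_itv /= => /andP[h1 h2]; apply/andP; split => //.
    exact: le_trans h2 yz.
  exact: le_trans xy h1.
(* By inclusion-exclusion the excess is the number of words counted on both sides; their domains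
   contain points on either side of [y]. *)
apply/card_le1_eqP => u w; rewrite !finset.inE.
have split_at v : meets [set` `[x, y]] v /\ meets [set` `[y, z]] v ->
    exists p q, [/\ D v p, D v q, p < y & y < q].
  move=> [/meetsP[p [q [_ + Dp _ pq]]] /meetsP[p' [q' [+ _ _ Dq' pq']]]].
  rewrite /= !in_itv /= => /andP[_ qy] /andP[yp' _].
  by exists p, q'; split => //; [exact: lt_le_trans qy | exact: le_lt_trans pq'].
move=> /andP[/asboolP hu1 /asboolP hu2] /andP[/asboolP hw1 /asboolP hw2].
have [p [q [Dup Duq py yq]]] := split_at _ (conj hu1 hu2).
have [p' [q' [Dwp Dwq p'y yq']]] := split_at _ (conj hw1 hw2).
(* Both domains contain the nondegenerate interval from [Num.max p p'] to [Num.min q q'], so the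
   words agree. *)
have py' : Num.max p p' < y by rewrite gt_max py.
have yq'' : y < Num.min q q' by rewrite lt_min yq.
have mM : Num.max p p' < Num.min q q' by exact: lt_trans yq''.
have inside v r t : D v r -> D v t -> r <= Num.max p p' -> Num.min q q' <= t ->
    D v (Num.max p p') /\ D v (Num.min q q').
  move=> Dr Dt h1 h2; split; apply: domain_convex Dr Dt _ _ => //.
    by apply: le_trans h2; exact: ltW.
  by apply: le_trans h1 _; exact: ltW.
have [||u1 u2] := inside u _ _ Dup Duq; rewrite ?le_max ?ge_min ?lexx //.
have [||w1 w2] := inside w _ _ Dwp Dwq; rewrite ?le_max ?ge_min ?lexx ?orbT //.
have sz : size u = size w by rewrite !size_tuple.
by have uw := domain_overlap_inj sz mM u1 u2 w1 w2; exact: val_inj.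
Qed.

(** Two points of [A] in a domain already lie in [piece c i], which forces the first letter to be
    [i]; removing it is then a bijection of words, since [f i] is injective. *)
Lemma cnt_shift i A m : A `<=` [set` piece c i] ->
  cnt A m.+1 = cnt (f i @` A) m.
Proof.
move=> Ai; pose g (w : m.-tuple 'I_l) := [tuple of i :: w].
have g_inj : injective g by move=> u w /(congr1 val)[] /val_inj.
rewrite [in RHS]/cnt -(fintype.card_image g_inj); apply: eq_card => w; rewrite !finset.inE.
apply/asboolP/fintype.imageP => [|[u + ->]]; last first.
  rewrite finset.inE => /asboolP[_ [_ [[p Ap <-] [q Aq <-] Dp Dq pq]]].
  exists p, q; split => //=; try by split => //; exact: Ai.
  by apply: contra_neq pq => ->.
case/tupleP: w => j w [p [q [Ap Aq [pj Dp] [qj Dq] pq]]].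
have ij : j = i.
  move: pq; rewrite neq_lt => /orP[] pq.
    exact: (piece_inj pq pj qj (Ai _ Ap) (Ai _ Aq)).
  exact: (piece_inj pq qj pj (Ai _ Aq) (Ai _ Ap)).
subst j; exists w; last exact: val_inj.
rewrite finset.inE; apply/asboolP; exists (f i p), (f i q).
by split; [exists p | exists q | exact: Dp | exact: Dq | exact: f_inj].
Qed.

(** Cutting a word after [m] letters is injective; the prefix keeps the same two points, the suffix
    receives their distinct images. *)
Lemma ell_submul m n : (ell c f (m + n) <= ell c f m * ell c f n)%N.
Proof.
rewrite !ell_cnt /cnt -cardX.
have sz1 (w : (m + n).-tuple 'I_l) : size (take m w) == m.
  by rewrite size_takel // size_tuple leq_addr.
have sz2 (w : (m + n).-tuple 'I_l) : size (drop m w) == n.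
  by rewrite size_drop size_tuple addKn.
pose g (w : (m + n).-tuple 'I_l) := (Tuple (sz1 w), Tuple (sz2 w)).
have g_inj : injective g.
  move=> u w [h1 h2]; apply: val_inj => /=.
  by rewrite -(cat_take_drop m u) -(cat_take_drop m w) h1 h2.
rewrite -(fintype.card_image g_inj).
apply/subset_leq_card/fintype.subsetP => _ /fintype.imageP[w + ->].
rewrite !finset.inE => /asboolP h; rewrite -(cat_take_drop m w) in h.
apply/andP; split; apply/asboolP; last exact: meets_cat_r h.
move: h => [p [q [Ap Aq Dp Dq pq]]].
by exists p, q; split => //=; exact: (@domain_cat_l _ (drop m w)).
Qed.

Lemma domain_closed w : closed (D w).
Proof.
elim: w => [|i w IH] /=; first exact: interval_closed.
rewrite setIC closed_setIS; last exact: interval_closed.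
by move/continuous_closedP: (@f_cont i); exact.
Qed.

Lemma piece_cover x : (0 < l)%N -> x \in whole c -> exists i, x \in piece c i.
Proof.
move=> l0; rewrite in_itv /= => /andP[ax xb]; apply/not_existsP => no.
(* A point outside every piece climbs past the cut points one by one, finally past the last.
   Strictness fails only at [k = 0], where [x] may equal [c ord0]. *)
have above k (hk : (k < l.+1)%N) :
    c (Ordinal hk) <= x /\ ((0 < k)%N -> c (Ordinal hk) < x).
  elim: k hk => [|k IH] hk.
    by split => //; apply: le_trans ax; exact: c_le.
  have [kx _] := IH (ltnW hk).
  suff h : c (Ordinal hk) < x by split => //; exact: ltW.
  have := no (Ordinal (hk : (k < l)%N)); rewrite in_itv /= => /negP.
  have -> : lpt c (Ordinal (hk : (k < l)%N)) = c (Ordinal (ltnW hk)).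
    by congr c; exact: val_inj.
  have -> : rpt c (Ordinal (hk : (k < l)%N)) = c (Ordinal hk).
    by congr c; exact: val_inj.
  by rewrite kx /= ltNge.
have [_ /(_ l0)] := above l (ltnSn l).
have -> : Ordinal (ltnSn l) = ord_max by exact: val_inj.
by rewrite ltNge xb.
Qed.

Lemma domain_cover m x : (0 < l)%N -> x \in whole c ->
  exists w : m.-tuple 'I_l, D w x.
Proof.
move=> l0; elim: m x => [|m IH] x xw; first by exists [tuple].
have [i xi] := piece_cover l0 xw.
by have [w wx] := IH _ (f_maps xi); exists [tuple of i :: w].
Qed.

(** The finitely many domains of length [m] are closed, so those missing [x] miss a neighbourhood of
    [x]; a nearby [y] can only be covered by a domain containing [x]. *)
Lemma near_domain m x : (0 < l)%N -> \forall y \near nbhs x, y \in whole c ->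
  exists w : m.-tuple 'I_l, D w x /\ D w y.
Proof.
move=> l0.
have loc (w : m.-tuple 'I_l) : \forall y \near nbhs x, D w y -> D w x.
  have [wx|nwx] := pselect (D w x); first by apply: nearW => y _.
  have : open_nbhs x (~` D w) by split => //; apply: closed_openC; exact: domain_closed.
  by move/open_nbhs_nbhs; apply: filterS => y nwy /nwy.
have := filter_forall (nbhs_filter x) loc; apply: filterS => y h yw.
have [w wy] := domain_cover m l0 yw.
by exists w; split => //; exact: h.
Qed.

End Words.
(** * The eigenfunction *)

Section Image.
Variable R : realType.
Implicit Types (g : R -> R) (x y : R).

Lemma image_itv_homo g x y : x <= y -> {within `[x, y], continuous g} ->
  {in `[x, y] &, {homo g : u v / u <= v}} ->
  g @` [set` `[x, y]] = [set` `[g x, g y]].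
Proof.
move=> xy cg mg; apply/seteqP; split => [_ [t /= txy <-]|v /= vg].
  have := txy; rewrite !in_itv /= => /andP[xt ty].
  by rewrite !mg // in_itv /= ?lexx ?xy.
have gxy : g x <= g y by rewrite mg // in_itv /= lexx xy.
exact: (segment_continuous_le_surjective xy gxy cg).
Qed.

Lemma image_itv_nhomo g x y : x <= y -> {within `[x, y], continuous g} ->
  {in `[x, y] &, {homo g : u v /~ u <= v}} ->
  g @` [set` `[x, y]] = [set` `[g y, g x]].
Proof.
move=> xy cg mg; apply/seteqP; split => [_ [t /= txy <-]|v /= vg].
  have := txy; rewrite !in_itv /= => /andP[xt ty].
  by rewrite !mg // in_itv /= ?lexx ?xy.
have gxy : g y <= g x by rewrite mg // in_itv /= lexx xy.
exact: (segment_continuous_ge_surjective xy gxy cg).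
Qed.

(** Compactness of the unit interval gives a cluster point, and a cluster point along an ultrafilter
    is a limit. *)
Lemma ultra_cvg (U : set_system nat) (u : nat -> R) : UltraFilter U ->
  (forall k, 0 <= u k <= 1) -> exists y : R, u k @[k --> U] --> y.
Proof.
move=> UU u01.
have [|y [_ uy]] := @segment_compact R 0 1 (u @ U) _.
  by apply: nearW => k /=; rewrite in_itv /=.
exists y => V yV; have [//|nV] := in_ultra_setVsetC (u @^-1` V) UU.
by have [z [nVz Vz]] := uy (~` V) V nV yV.
Qed.

(** Turns relations that hold up to an error of order [1 / k] into exact relations between limits
    along [U]. *)
Lemma cvg_le_harmonic_eq0 (U : set_system nat) (u : nat -> R) (y C : R) :
  ProperFilter U -> \oo `<=` U -> u k @[k --> U] --> y ->
  (forall k, `|u k| <= C / k.+1%:R) -> y = 0.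
Proof.
move=> UU ooU uy uC; apply: (cvg_unique _ uy) => //.
apply/cvgrPdist_le => e e0; apply: ooU.
have : C * k.+1%:R^-1 @[k --> \oo] --> C * (0 : R).
  by apply: cvgMr; exact: cvg_harmonic.
rewrite mulr0 => /cvgr_le /(_ e e0); apply: filterS => k Ck.
by rewrite sub0r normrN; exact: le_trans (uC k) Ck.
Qed.

End Image.

(** * Weighted partial sums of the counts and their limit *)

Section Semiconjugacy.
Variables (R : realType) (l : nat) (c : 'I_l.+1 -> R).
Hypothesis l_gt0 : (0 < l)%N.
Hypothesis hc : {homo c : i j / (i < j)%N >-> i < j}.
Variable f : 'I_l -> R -> R.
Hypothesis f_cont : forall i, {within [set` piece c i], continuous (f i)}.
Hypothesis f_mono : forall i,
  increasing_on (piece c i) (f i) \/ decreasing_on (piece c i) (f i).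
Hypothesis f_maps : forall i, {homo f i : x / x \in piece c i >-> x \in whole c}.

Local Notation D := (natural_domain c f).
Local Notation L := (ell c f).
Local Notation s := (growth c f).
Local Notation a := (c ord0).
Local Notation b := (c ord_max).

Hypothesis s_gt1 : 1 < s.

Let s_gt0 : 0 < s. Proof. exact: lt_trans s_gt1. Qed.

Let s_ge0 : 0 <= s. Proof. exact: ltW. Qed.

Let sX_ge0 m : 0 <= s ^+ m. Proof. exact: exprn_ge0. Qed.

Lemma whole_nondegenerate : a < b.
Proof. exact: hc. Qed.

Lemma cnt_le_ell A m : (cnt c f A m <= L m)%N.
Proof.
rewrite ell_cnt //; apply/subset_leq_card/fintype.subsetP => w; rewrite !finset.inE.
move=> /asboolP[p [q [_ _ Dp Dq pq]]]; apply/asboolP; exists p, q.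
by split => //; apply: (domain_sub_whole hc (w := w) (f := f)).
Qed.

Lemma ell0 : L 0 = 1%N.
Proof.
rewrite ell_cnt // /cnt -[RHS](expn0 #|'I_l|) -card_tuple; apply: eq_card => w.
rewrite tuple0 !finset.inE; apply/asboolP; exists a, b.
have ab := whole_nondegenerate.
by split; rewrite /= ?in_itv /= ?lexx ?(ltW ab) // lt_eqF.
Qed.

(** Partial sum, at t = 1/s, of the generating function of the counts. For the whole interval 1/s is
    the radius of convergence, and the series diverges there. *)
Definition psum N (A : set R) : R := \sum_(m < N) (cnt c f A m)%:R / s ^+ m.

Local Notation T N := (psum N [set` whole c]).

Lemma psum_ge0 N A : 0 <= psum N A.
Proof. by apply: sumr_ge0 => m _; rewrite divr_ge0. Qed.

Lemma psum_sub N A B : A `<=` B -> psum N A <= psum N B.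
Proof.
move=> AB; apply: ler_sum => m _; rewrite ler_pM2r ?invr_gt0 ?exprn_gt0 //.
by rewrite ler_nat cnt_sub.
Qed.

Lemma psum_le_whole N A : psum N A <= T N.
Proof.
apply: ler_sum => m _; rewrite ler_pM2r ?invr_gt0 ?exprn_gt0 //.
by rewrite ler_nat -ell_cnt // cnt_le_ell.
Qed.

(** Sum of the full geometric series of ratio 1/s: the total defect when every count is off by at
    most 1. *)
Let K := s / (s - 1).

Lemma geometric_psum N : \sum_(m < N) (s ^+ m)^-1 <= K.
Proof.
suff -> : \sum_(m < N) (s ^+ m)^-1 = K - K / s ^+ N.
  by rewrite lerBlDr lerDl !divr_ge0 // subr_ge0 ltW.
elim: N => [|N IH]; first by rewrite big_ord0 expr0 divr1 subrr.
rewrite big_ord_recr /= IH exprS /K; field.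
by rewrite expf_neq0 ?gt_eqF // subr_gt0.
Qed.

Lemma psum_split N x y z : x <= y -> y <= z ->
  `|psum N [set` `[x, z]] - (psum N [set` `[x, y]] + psum N [set` `[y, z]])| <= K.
Proof.
move=> xy yz; apply: le_trans (geometric_psum N).
rewrite -big_split -sumrB /=; apply: le_trans (ler_norm_sum _ _ _) _.
apply: ler_sum => m _; rewrite -mulrDl -mulrBl normrM.
rewrite [X in _ * X]ger0_norm ?invr_ge0 //.
rewrite ler_piMl ?invr_ge0 //.
have h1 := cnt_split f_mono m xy yz; have h2 := cnt_join hc f_mono m xy yz.
rewrite -(ler_nat R) natrD in h1; rewrite -(ler_nat R) !natrD in h2.
by rewrite ler_norml; apply/andP; split; lra.
Qed.

(** By [cnt_shift] the image sum is [s] times the sum over lengths 1 to [N]. Only the end terms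
    differ: length 0 contributes at most 1, length [N] at most [L N / s ^+ N]. *)
Lemma psum_shift i N A : A `<=` [set` piece c i] ->
  `|psum N (f i @` A) - s * psum N A| <= s * (1 + (L N)%:R / s ^+ N).
Proof.
move=> Ai.
have -> : psum N (f i @` A) = s * (psum N.+1 A - (cnt c f A 0)%:R).
  rewrite [X in _ * (X - _)]/psum big_ord_recl expr0 divr1 addrAC subrr add0r.
  rewrite mulr_sumr; apply: eq_bigr => m _.
  rewrite lift0 -(cnt_shift hc f_mono m Ai) exprS; field.
  by rewrite expf_neq0 ?gt_eqF.
rewrite /psum big_ord_recr /= -/(psum N A) -mulrBr normrM gtr0_norm //.
rewrite ler_pM2l // addrAC [X in _ <= X]addrC.
rewrite [X in `|X|](_ : _ = (cnt c f A N)%:R / s ^+ N - (cnt c f A 0)%:R); last by ring.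
apply: le_trans (ler_normB _ _) _; apply: lerD.
  by rewrite ger0_norm ?divr_ge0 // ler_pM2r ?invr_gt0 ?exprn_gt0 // ler_nat cnt_le_ell.
by rewrite ger0_norm // lern1 -ell0 cnt_le_ell.
Qed.

Lemma ell_ge_exp m : s ^+ m <= (L m)%:R.
Proof.
apply: (@growth_lower R (fun m => (L m)%:R)) => //; first by rewrite ell0.
by move=> n p; rewrite -natrM ler_nat ell_submul.
Qed.

(** Apply [exists_small_term] with [eps = 1 / k.+1]. The small term is still at least 1 by
    [ell_ge_exp], which forces the partial sum up to [k.+1]. *)
Lemma exists_psum_index : exists N_ : nat -> nat, forall k,
  [/\ k.+1%:R <= T (N_ k) & (L (N_ k))%:R / s ^+ (N_ k) <= T (N_ k) / k.+1%:R].
Proof.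
have small k : exists N, (L N)%:R / s ^+ N <= T N / k.+1%:R.
  have e0 : 0 < (k.+1%:R : R)^-1 by rewrite invr_gt0.
  have [||||N] := @exists_small_term R (fun m => (L m)%:R) _ _ _ _ _ e0 => //.
  - by rewrite ell0.
  - by move=> n p; rewrite -natrM ler_nat ell_submul.
  move=> hN; exists N; apply: le_trans hN _; rewrite mulrC ler_pM2r //.
  by apply: ler_sum => m _; rewrite ell_cnt.
have [N_ hN] := choice small.
exists N_ => k; split => //.
have : 1 <= (L (N_ k))%:R / s ^+ (N_ k).
  by rewrite ler_pdivlMr ?exprn_gt0 // mul1r ell_ge_exp.
by move=> /le_trans /(_ (hN k)); rewrite ler_pdivlMr // mul1r.
Qed.

Lemma exists_eigenfunction : exists phi : R -> R,
  [/\ phi a = 0, phi b = 1, {in whole c &, {homo phi : x y / x <= y}} &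
    forall i, {in piece c i &, forall x y,
      phi (f i y) - phi (f i x) = sigma (piece c i) (f i) * s * (phi y - phi x)}].
Proof.
have [N_ hN] := exists_psum_index.
(* A single ultrafilter refining [\oo] gives limits for all [x] simultaneously. *)
have [U [UU ooU]] := @ultraFilterLemma nat \oo _.
have T_ge k : k.+1%:R <= T (N_ k) by have [] := hN k.
have T_gt0 k : 0 < T (N_ k) by apply: lt_le_trans (T_ge k).
have T_ge0 k : 0 <= T (N_ k) by exact: ltW.
pose phi_ k x := psum (N_ k) [set` `[a, x]] / T (N_ k).
have phi_01 k x : 0 <= phi_ k x <= 1.
  rewrite divr_ge0 ?psum_ge0 //= ler_pdivrMr // mul1r.
  exact: psum_le_whole.
have /choice[phi phiE] : forall x, exists y : R, phi_ k x @[k --> U] --> y.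
  by move=> x; exact: ultra_cvg.
have homo_phi : {in whole c &, {homo phi : x y / x <= y}}.
  move=> x y _ _ xy; apply: ler_cvg_to (phiE x) (phiE y) _.
  apply: nearW => k; rewrite ler_pM2r ?invr_gt0 //; apply: psum_sub => t /=.
  by rewrite !in_itv /= => /andP[-> /le_trans]; exact.
(* Stated through the image interval, so that both orientations of the branch are instances. *)
have eigen i x y u v : x <= y -> x \in piece c i -> y \in piece c i ->
    u <= v -> u \in whole c -> v \in whole c ->
    f i @` [set` `[x, y]] = [set` `[u, v]] ->
    phi v - phi u = s * (phi y - phi x).
  move=> xy xi yi uv uw vw img; apply/eqP; rewrite -subr_eq0; apply/eqP.
  (* [K] and [s * K] pay for the cuts at [u] and [x], and [s * 2] for the two end terms of the
     shift. Both 1 and [L N / s ^+ N] are at most [T N / k.+1%:R], so after division by [T N] the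
     error is at most [C / k.+1%:R]. *)
  pose C := K + s * 2 + s * K.
  pose defect k := phi_ k v - phi_ k u - s * (phi_ k y - phi_ k x).
  apply: (@cvg_le_harmonic_eq0 R U defect _ C _ ooU).
    apply: cvgB; first exact: cvgB.
    by apply: cvgMr; exact: cvgB.
  move=> k; have [_ small] := hN k; set N := N_ k in small.
  have TN_gt0 : 0 < T N by exact: T_gt0.
  have TN_ge0 : 0 <= T N by exact: ltW.
  pose P z := psum N [set` `[a, z]].
  have -> : defect k =
      (P v - P u - s * (P y - P x)) / T N.
    by rewrite /defect /phi_ -/N -!mulrBl mulrA -mulrBl.
  rewrite normrM [X in _ * X]ger0_norm ?invr_ge0 //.
  rewrite ler_pdivrMr // mulrAC -mulrA.
  have ge_a z : z \in whole c -> a <= z by rewrite in_itv /= => /andP[].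
  have h1 := psum_split N (ge_a _ uw) uv.
  have h2 := psum_split N (ge_a _ (piece_sub_whole hc xi)) xy.
  have h3 : `|psum N (f i @` [set` `[x, y]]) - s * psum N [set` `[x, y]]| <=
      s * (1 + (L N)%:R / s ^+ N).
    apply: psum_shift => t /=; move: xi yi; rewrite !in_itv /= => /andP[xl _] /andP[_ yr].
    by move=> /andP[xt ty]; rewrite (le_trans xl xt) (le_trans ty yr).
  rewrite img in h3.
  have {}h2 := ler_wpM2l s_ge0 h2.
  rewrite -{1}[s](ger0_norm s_ge0) -normrM mulrBr mulrDr in h2.
  have t1 : 1 <= T N / k.+1%:R by rewrite ler_pdivlMr // mul1r.
  move: small t1; rewrite -/N; set q := (_ / s ^+ N) in h3 *; set t := (T N / _).
  move=> qt t1.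
  have K0 : 0 <= K by rewrite divr_ge0 // subr_ge0 ltW.
  apply: (@le_trans _ _ (K + s * (1 + q) + s * K)).
    move: h1 h2 h3; rewrite -!/(P _) !ler_norml => /andP[? ?] /andP[? ?] /andP[? ?].
    by apply/andP; split; lra.
  have e1 : K <= K * t by rewrite ler_peMr.
  have e2 : s <= s * t by rewrite ler_peMr.
  have e3 : s * q <= s * t by rewrite ler_wpM2l.
  have e4 : s * K <= s * K * t by rewrite ler_peMr // mulr_ge0.
  by rewrite /C; lra.
exists phi; split => //.
- have := phiE a; have -> : phi_ ^~ a = cst 0.
    apply/funext => k; rewrite /phi_ /psum big1 ?mul0r // => m _.
    by rewrite cnt_itv_xx mul0r.
  by move=> /cvg_unique; apply => //; exact: cvg_cst.
- have := phiE b; have -> : phi_ ^~ b = cst 1.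
    by apply/funext => k; rewrite /phi_ divff // gt_eqF.
  by move=> /cvg_unique; apply => //; exact: cvg_cst.
move=> i x y xi yi.
wlog xy : x y xi yi / x <= y.
  move=> H; have [xy|yx] := leP x y; first exact: H.
  by rewrite -opprB (H y x) ?ltW // -mulrN opprB.
have xyi : [set` `[x, y]] `<=` [set` piece c i].
  move=> t /=; move: xi yi; rewrite !in_itv /= => /andP[xl _] /andP[_ yr].
  by move=> /andP[xt ty]; rewrite (le_trans xl xt) (le_trans ty yr).
have cf := continuous_subspaceW xyi (@f_cont i).
have xx : x \in `[x, y] by rewrite in_itv /= lexx.
have yy : y \in `[x, y] by rewrite in_itv /= lexx xy.
rewrite /sigma; case: asboolP => inc.
  have mf : {in `[x, y] &, {homo f i : u v / u <= v}}.
    move=> u v /xyi ui /xyi vi; rewrite le_eqVlt => /orP[/eqP->//|uv].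
    exact/ltW/inc.
  rewrite mul1r; apply: (eigen i) => //; try exact: f_maps; first exact: mf.
  exact: image_itv_homo.
(* A decreasing branch swaps the endpoints of the image, which produces the sign -1. *)
have [//|dec] := f_mono i.
have mf : {in `[x, y] &, {homo f i : u v /~ u <= v}}.
  move=> u v /xyi ui /xyi vi; rewrite le_eqVlt => /orP[/eqP->//|uv].
  exact/ltW/dec.
rewrite mulN1r mulNr -(eigen i x y (f i y) (f i x)) ?opprB //; try exact: f_maps.
  exact: mf.
exact: image_itv_nhomo.
Qed.

(** * Continuity of the eigenfunction *)

Section Eigenfunction.
Variable phi : R -> R.
Hypothesis phi_a : phi a = 0.
Hypothesis phi_b : phi b = 1.
Hypothesis phi_homo : {in whole c &, {homo phi : x y / x <= y}}.
Hypothesis phi_eigen : forall i, {in piece c i &, forall x y,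
  phi (f i y) - phi (f i x) = sigma (piece c i) (f i) * s * (phi y - phi x)}.

Lemma eigenfunction_01 x : x \in whole c -> 0 <= phi x <= 1.
Proof.
have ab := ltW whole_nondegenerate.
move=> xw; move: (xw); rewrite in_itv /= => /andP[ax xb].
by rewrite -phi_a -phi_b !phi_homo // in_itv /= lexx ab.
Qed.

(** Each letter stretches the difference of values by the factor [s], and after the whole word it is
    still at most 1 because [phi] takes values in the unit interval. *)
Lemma eigenfunction_dist_domain w x y :
  D w x -> D w y -> `|phi y - phi x| <= (s ^+ size w)^-1.
Proof.
elim: w x y => [|i w IH] x y /=.
  move=> /eigenfunction_01/andP[x0 x1] /eigenfunction_01/andP[y0 y1].
  by rewrite expr0 invr1 ler_norml; apply/andP; split; lra.
move=> [xi xw] [yi yw]; have := IH _ _ xw yw; rewrite phi_eigen //.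
have norm_sigma : `|sigma (piece c i) (f i)| = 1.
  by rewrite /sigma; case: ifP => _; rewrite ?normrN normr1.
rewrite !normrM norm_sigma mul1r (gtr0_norm s_gt0) exprS invfM.
by rewrite [X in _ -> _ <= X]mulrC ler_pdivlMr // mulrC.
Qed.

Lemma eigenfunction_continuous : {within [set` whole c], continuous phi}.
Proof.
apply/subspace_continuousP => x xw; apply/cvgrPdist_le => e e0.
have [n _ /(_ n (leqnn n)) sn] := @exp_eventually_large R e^-1 s s_gt1.
have := near_domain hc f_cont f_maps n x l_gt0.
rewrite near_withinE; apply: filterS => y h yw.
have [w [wx wy]] := h yw; rewrite distrC.
have := eigenfunction_dist_domain wx wy; rewrite size_tuple => /le_trans; apply.
by rewrite -[e]invrK lef_pV2 // posrE ?invr_gt0 // exprn_gt0.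
Qed.

Lemma eigenfunction_image x y : x <= y -> x \in whole c -> y \in whole c ->
  phi @` [set` `[x, y]] = [set` `[phi x, phi y]].
Proof.
move=> xy xw yw.
have xyw : [set` `[x, y]] `<=` [set` whole c].
  move=> t /=; move: xw yw; rewrite !in_itv /= => /andP[ax _] /andP[_ yb].
  by move=> /andP[xt ty]; rewrite (le_trans ax xt) (le_trans ty yb).
apply: image_itv_homo => //.
  exact: continuous_subspaceW xyw eigenfunction_continuous.
by move=> u v /xyw uw /xyw vw; exact: phi_homo.
Qed.

End Eigenfunction.

End Semiconjugacy.

(** * The semiconjugacy to an affine system *)

Theorem mainTheorem6 (R : realType) (l : nat) (hl : (1 <= l)%N)
    (c : 'I_l.+1 -> R) (hc : {homo c : i j / (i < j)%N >-> i < j})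
    (f : 'I_l -> R -> R)
    (f_cont : forall i, {within [set` piece c i], continuous (f i)})
    (f_mono : forall i,
      increasing_on (piece c i) (f i) \/ decreasing_on (piece c i) (f i))
    (f_maps : forall i, {homo f i : x / x \in piece c i >-> x \in whole c})
    (h_entropy : 0 < entropy c f) :
  exists (phi : R -> R) (ct : 'I_l.+1 -> R) (ft : 'I_l -> R -> R),
    [/\ {within [set` whole c], continuous phi},
        phi @` [set` whole c] = [set` `[0, 1]],
        {in whole c &, {homo phi : x y / x <= y}},
        [/\ ct ord0 = 0, ct ord_max = 1,
            {homo ct : i j / (i <= j)%N >-> i <= j} &
            forall i, phi @` [set` piece c i] = [set` piece ct i]] &
        forall i : 'I_l,
          [/\ {homo ft i : y / y \in piece ct i >-> y \in `[0, 1]},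
              {in piece ct i, forall y,
                 ft i y = sigma (piece c i) (f i) * growth c f * (y - lpt ct i)
                          + ft i (lpt ct i)} &
              {in piece c i, forall x, ft i (phi x) = phi (f i x)}]].
Proof.
(* [ln] is nonpositive at every real up to 1, including the nonpositive ones where it has a default
   value. *)
have s1 : 1 < growth c f.
  by rewrite ltNge; apply/negP => /ln_le0; rewrite leNgt => /negP; exact.
have [phi [phia phib mphi eig]] := exists_eigenfunction hl hc f_cont f_mono f_maps s1.
have cphi := eigenfunction_continuous hl hc f_cont f_maps s1 phia phib mphi eig.
have img := eigenfunction_image hl hc f_cont f_maps s1 phia phib mphi eig.
have cw i : c i \in whole c.
  by rewrite in_itv /= !(c_le hc) // -ltnS ltn_ord.
have pieceE i : phi @` [set` piece c i] = [set` piece (phi \o c) i].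
  by apply: img; rewrite ?cw // ltW // lpt_lt_rpt.
(* Anchoring the affine map at the left endpoint makes it meaningful even when [phi] collapses the
   piece to a point; [eig] based at [lpt c i] is then the conjugacy relation. *)
pose ft i y := sigma (piece c i) (f i) * growth c f * (y - phi (lpt c i)) + phi (f i (lpt c i)).
have lp i : lpt c i \in piece c i by rewrite in_itv /= lexx ltW // lpt_lt_rpt.
have ftE i x : x \in piece c i -> ft i (phi x) = phi (f i x).
  by move=> xi; rewrite /ft -eig // subrK.
exists phi, (phi \o c), ft; split => //.
- by rewrite -phia -phib; apply: img => //; apply: c_le.
- split => // i j ij; apply: mphi; rewrite ?cw //; exact: c_le.
move=> i; split.
- move=> y yi; have : [set` piece (phi \o c) i] y by [].
  rewrite -pieceE => -[x /= xi <-]; rewrite ftE //.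
  by rewrite in_itv /= (eigenfunction_01 hl hc phia phib mphi) // f_maps.
- by move=> y _; rewrite /ft subrr mulr0 add0r.
- by move=> x xi; rewrite ftE.
Qed.
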